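(* Let $\phi(x)=\sum_{n=0}^\infty \alpha_n x^n$ be a formal power series with real coefficients, and write $\phi^{(n)}(0)=n!\,\alpha_n$. Suppose that $\phi(0)\neq 0$ and $\phi''(0)\phi(0)-\phi'(0)^2<0$. Then for every real polynomial $f$ there is a positive integer $m_0$ such that all the zeros of $\phi(D)^m f$ are real and simple whenever $m\ge m_0$.
   Context: $D$ denotes differentiation. For a formal power series $\phi(x)=\sum_{n\ge 0}\alpha_n x^n$ (not assumed convergent) and a polynomial $f$, $\phi(D)f=\sum_{n\ge 0}\alpha_n f^{(n)}$, which is a finite sum, and $\phi(D)^m f$ denotes the result of applying the operator $\phi(D)$ to $f$ $m$ times. The symbol $\phi^{(n)}(0)$ stands for $n!\,\alpha_n$ even if the radius of convergence of $\phi$ is $0$; in particular $\phi(0)=\alpha_0$, $\phi'(0)=\alpha_1$ and $\phi''(0)=2\alpha_2$. A real polynomial is a polynomial with real coefficients. *)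

(* Defs.v *)
From HB Require Import structures.
From mathcomp Require Import all_boot all_order all_algebra.
From mathcomp Require Import complex reals.

Set Implicit Arguments.
Unset Strict Implicit.
Unset Printing Implicit Defensive.

Import Order.TTheory GRing.Theory Num.Theory.
Local Open Scope ring_scope.

(* A formal power series over R is its coefficient sequence; no convergence is
   assumed, so [fps_deriv0 phi n] is the formal phi^(n)(0). *)
Definition fps (R : Type) := nat -> R.

Definition fps_deriv0 (R : realType) (phi : fps R) (n : nat) : R :=
  n`!%:R * phi n.

(* phi(D) f = \sum_(n >= 0) phi n *: f^`(n); the terms with n >= size f are
   zero, so truncating at any N >= size f gives the same value
   ([fps_diffopE]). *)
Definition fps_diffop (R : realType) (phi : fps R) (f : {poly R}) : {poly R} :=
  \sum_(n < size f) phi n *: f^`(n).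

Lemma fps_diffopE (R : realType) (phi : fps R) (f : {poly R}) (N : nat) :
  (size f <= N)%N -> fps_diffop phi f = \sum_(n < N) phi n *: f^`(n).
Proof.
move=> leN; rewrite /fps_diffop (big_ord_widen N (fun n => phi n *: f^`(n))) //.
rewrite big_mkcond; apply: eq_bigr => i _; case: ltnP => // le_i.
by rewrite derivn_poly0 ?scaler0.
Qed.

(* The zeros are those in the complex numbers R[i]. *)
Definition all_zeros_real_simple (R : realType) (p : {poly R}) : Prop :=
  let pC : {poly R[i]} := map_poly (real_complex R) p in
  forall z : R[i], root pC z -> complex.Im z = 0 /\ mup z pC = 1%N.

(* Main.v *)
Require Import Defs.
From HB Require Import structures.
From mathcomp Require Import all_boot all_order all_algebra.
From mathcomp Require Import complex reals.
From mathcomp Require Import polyorder polyrcf cauchyreals ring.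
From mathcomp Require Import boolp classical_sets functions topology normedtype.
From mathcomp Require Import sequences realfun.

(* After division by phi(0) and multiplication by exp(-a x), where
   a = phi'(0)/phi(0), the series phi becomes psi = 1 + b x^2 + ... with b < 0;
   this only rescales phi(D)^m f and translates it by m a.  As in the central
   limit theorem, m^(-d/2) (psi(D)^m f)(sqrt m * y), with d = deg f, tends to
   lc(f) (exp(b D^2) x^d)(y): the coefficients of psi^m satisfy the recurrence
   given by psi (psi^m)' = m psi' psi^m, in which only the x^2 term of psi
   survives the scaling.  The limit is a Hermite polynomial, which takes values
   of alternating signs at d + 1 suitable points.  So does psi(D)^m f for large
   m, and the intermediate value theorem yields d distinct real zeros. *)

Set Implicit Arguments.
Unset Strict Implicit.
Unset Printing Implicit Defensive.

Import Order.TTheory GRing.Theory Num.Theory.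
Import numFieldNormedType.Exports.
Local Open Scope ring_scope.

(** * Differential operators with constant coefficients *)

Section DiffOp.
Variable R : realType.
Implicit Types (phi : fps R) (f g p q : {poly R}).

Lemma fps_diffop_deriv phi f : fps_diffop phi f^`() = (fps_diffop phi f)^`().
Proof.
rewrite (@fps_diffopE _ _ f^`() (size f)) ?size_deriv ?leq_pred //.
rewrite /fps_diffop raddf_sum; apply: eq_bigr => i _ /=.
by rewrite derivZ -derivnS -derivSn.
Qed.

Lemma size_fps_diffop_le phi f : (size (fps_diffop phi f) <= size f)%N.
Proof.
apply: (leq_trans (size_sum _ _ _)); apply/bigmax_leqP => i _.
by rewrite (leq_trans (size_scale_leq _ _)) // size_derivn leq_subr.
Qed.

Lemma size_fps_diffop phi f : phi 0%N != 0 -> size (fps_diffop phi f) = size f.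
Proof.
move=> phi0; have [->|f0] := eqVneq f 0.
  by rewrite /fps_diffop size_poly0 big_ord0 size_poly0.
have sf : (0 < size f)%N by rewrite size_poly_gt0.
rewrite /fps_diffop -(prednK sf) big_ord_recl /= size_polyDl ?prednK //.
  by rewrite size_scale.
rewrite size_scale // -[X in (_ < X)%N](prednK sf) ltnS.
apply: (leq_trans (size_sum _ _ _)); apply/bigmax_leqP => i _.
apply: leq_trans (size_scale_leq _ _) _; rewrite size_deriv size_derivn.
by have := leq_sub2r 1 (leq_subr (0 + i)%N (size f)); rewrite !subn1.
Qed.

Lemma size_iter_fps_diffop phi f m :
  phi 0%N != 0 -> size (iter m (fps_diffop phi) f) = size f.
Proof. by move=> phi0; elim: m => //= m <-; rewrite size_fps_diffop. Qed.

(** Polynomial symbols form a ring, so composing operators becomes multiplying symbols. *)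
Definition poly_diffop p f : {poly R} := fps_diffop (fun i => p`_i) f.

Lemma poly_diffopDl p q f :
  poly_diffop (p + q) f = poly_diffop p f + poly_diffop q f.
Proof.
rewrite /poly_diffop /fps_diffop -big_split; apply: eq_bigr => i _ /=.
by rewrite coefD scalerDl.
Qed.

Lemma poly_diffopZl c p f : poly_diffop (c *: p) f = c *: poly_diffop p f.
Proof.
rewrite /poly_diffop /fps_diffop scaler_sumr; apply: eq_bigr => i _.
by rewrite coefZ scalerA.
Qed.

Lemma poly_diffopC c f : poly_diffop c%:P f = c *: f.
Proof.
rewrite /poly_diffop (@fps_diffopE _ _ f (size f).+1) // big_ord_recl /=.
rewrite coefC eqxx big1 ?addr0 // => i _.
by rewrite /= coefC /bump scale0r.
Qed.

Lemma poly_diffopMX p f : poly_diffop (p * 'X) f = poly_diffop p f^`().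
Proof.
rewrite /poly_diffop (@fps_diffopE _ _ f (size f).+1) //.
rewrite (@fps_diffopE _ _ f^`() (size f)) ?size_deriv ?leq_pred //.
rewrite big_ord_recl coefMX eqxx scale0r add0r; apply: eq_bigr => i _.
by rewrite coefMX lift0 -derivSn.
Qed.

(** Induction on [p] in Horner form: a factor ['X] acts as one derivation, which commutes with the
    operator of [q]. *)
Lemma poly_diffopM p q f :
  poly_diffop (p * q) f = poly_diffop p (poly_diffop q f).
Proof.
elim/poly_ind: p f => [|p c IHp] f.
  by rewrite mul0r (_ : 0 = 0%:P) // !poly_diffopC !scale0r.
rewrite mulrDl !poly_diffopDl mul_polyC poly_diffopZl poly_diffopC.
rewrite -mulrA ['X * _]mulrC mulrA !poly_diffopMX IHp.
by rewrite {2}/poly_diffop fps_diffop_deriv.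
Qed.

(** The operator never raises the size, so at every iteration only the first [N] coefficients of
    [phi] act. *)
Lemma iter_fps_diffop phi f N m : (size f <= N)%N ->
  iter m (fps_diffop phi) f = poly_diffop ((\poly_(i < N) phi i) ^+ m) f.
Proof.
move=> sf; elim: m => [|m IHm].
  by rewrite expr0 -polyC1 poly_diffopC scale1r.
rewrite iterS IHm exprS poly_diffopM.
set g := poly_diffop _ f.
have sg : (size g <= N)%N by apply: leq_trans sf; apply: size_fps_diffop_le.
rewrite /poly_diffop !(@fps_diffopE _ _ g N) //.
by apply: eq_bigr => i _; rewrite coef_poly ltn_ord.
Qed.

(* Taylor's formula: the truncation of exp(c X) acts on polynomials of small
   degree as the translation by c. *)
Lemma horner_expX_diffop c f N m : (size f <= N)%N -> forall x : R,
  (poly_diffop ((\poly_(i < N) (c ^+ i / i`!%:R)) ^+ m) f).[x]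
  = f.[x + c *+ m].
Proof.
move=> sf; elim: m => [|m IHm] x.
  by rewrite expr0 -polyC1 poly_diffopC scale1r addr0.
rewrite exprS poly_diffopM.
set g := poly_diffop _ f in IHm *.
have sg : (size g <= N)%N by apply: leq_trans sf; apply: size_fps_diffop_le.
rewrite mulrS addrA -IHm nderiv_taylor; last exact: mulrC.
rewrite /poly_diffop /fps_diffop horner_sum; apply: eq_bigr => i _.
rewrite coef_poly (leq_trans (ltn_ord i)) // hornerZ nderivn_def hornerMn.
have i0 : i`!%:R != 0 :> R by rewrite pnatr_eq0 -lt0n fact_gt0.
by rewrite -[_ *+ _]mulr_natr; field.
Qed.

End DiffOp.

(** * Sign alternation and real roots *)

Section RealRoots.
Variable R : realType.
Implicit Types (p q : {poly R}) (rs zs : seq R).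

Lemma prod_XsubC_zeros_real_simple (c : R) rs : c != 0 -> uniq rs ->
  all_zeros_real_simple (c *: \prod_(r <- rs) ('X - r%:P)).
Proof.
move=> c0 urs; rewrite /all_zeros_real_simple.
have cC0 : real_complex R c != 0 by rewrite fmorph_eq0.
rewrite map_polyZ -(prod_map_poly _ _ xpredT) => z.
rewrite rootZ // root_prod_XsubC => zin.
split; first by case/mapP: zin => r _ ->.
rewrite -mul_polyC mupMr ?rootC // mu_prod_XsubC.
rewrite count_uniq_mem ?zin // map_inj_uniq //; exact: fmorph_inj.
Qed.

(** The exponent counts from the right end, so the last value is positive, as for a monic polynomial
    far to the right. *)
Definition alternates_on q zs := forall i, (i < size zs)%N ->
  0 < (-1) ^+ ((size zs).-1 - i) * q.[zs`_i].

Lemma alternates_on_roots q zs : zs != [::] -> sorted <%R zs ->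
    alternates_on q zs ->
  exists rs, [/\ sorted <%R rs, (size rs).+1 = size zs & all (root q) rs].
Proof.
move=> zs0 szs alt.
pose n := (size zs).-1.
have sz : size zs = n.+1 by rewrite /n prednK // lt0n size_eq0.
have ivt (i : 'I_n) : {r : R | zs`_i < r < zs`_i.+1 & root q r}.
  have lti : (i.+1 < size zs)%N by rewrite sz ltnS.
  have /ltW le_z : zs`_i < zs`_i.+1 by move/sortedP: szs; apply.
  have [|r] := poly_ivtoo le_z (p := q).
    have:= mulr_gt0 (alt i (ltnW lti)) (alt i.+1 lti).
    rewrite mulrACA sz /= -(subnSK (ltn_ord i)) exprS mulN1r mulNr.
    by rewrite -expr2 sqrr_sign mulN1r oppr_gt0.
  by rewrite in_itv /=; exists r.
(* The default 0 is taken only for [i >= n], outside the range of [mkseq r n]. *)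
pose r (i : nat) : R := if insub i is Some j then s2val (ivt j) else 0.
have rP i : (i < n)%N -> zs`_i < r i < zs`_i.+1 /\ root q (r i).
  by move=> lti; rewrite /r insubT; case: (ivt _).
exists (mkseq r n); split.
- apply/(sortedP 0) => i; rewrite size_mkseq => lti.
  rewrite !nth_mkseq // ?(ltnW lti) //.
  have [/andP[_ h1] _] := rP i (ltnW lti); have [/andP[h2 _] _] := rP _ lti.
  exact: lt_trans h2.
- by rewrite size_mkseq.
- rewrite all_map; apply/allP => i; rewrite mem_iota => /= lti.
  by case: (rP i lti).
Qed.

Lemma all_roots_sorted_prod_XsubC q rs :
    size q = (size rs).+1 -> sorted <%R rs -> all (root q) rs ->
  q = lead_coef q *: \prod_(r <- rs) ('X - r%:P).
Proof.
move=> sq srs rrs; apply: all_roots_prod_XsubC => //.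
by rewrite uniq_rootsE lt_sorted_uniq.
Qed.

(** At a root only the product of its differences with the other roots survives; each root further
    right contributes one minus sign. *)
Lemma sign_deriv_prod_XsubC rs i : sorted <%R rs -> (i < size rs)%N ->
  0 < (-1) ^+ ((size rs).-1 - i) * (\prod_(r <- rs) ('X - r%:P))^`().[rs`_i].
Proof.
move=> srs lti; rewrite (big_nth 0) big_mkord.
set n := size rs in lti *.
rewrite (bigD1 (Ordinal lti)) //= derivM hornerD !hornerM hornerXsubC subrr.
rewrite mul0r addr0 derivXsubC hornerC mul1r horner_prod.
(* Spread the sign over the factors, one -1 for each [j > i], so that positivity can be checked
   factor by factor. *)
have -> : (-1) ^+ (n.-1 - i) =
    \prod_(j < n | j != Ordinal lti) (-1) ^+ (i < j)%N :> R.
  rewrite prodrXr; congr (_ ^+ _).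
  transitivity (\sum_(j < n) (i < j : nat))%N; last first.
    by rewrite [LHS](bigD1 (Ordinal lti)) //= ltnn add0n.
  transitivity (\sum_(0 <= j < n) (i < j : nat))%N; last by rewrite big_mkord.
  rewrite (@big_cat_nat _ _ _ i.+1) //= big_nat big1 ?add0n; last first.
    by move=> j /andP[_]; rewrite ltnS leqNgt => /negbTE ->.
  rewrite big_nat (eq_bigr (fun=> 1%N)); last by move=> j /andP[-> _].
  by rewrite -big_nat sum_nat_const_nat muln1 subnS -subn1 subnAC subn1.
rewrite -big_split /=; apply: prodr_gt0 => j jNi.
have mono a b : (a < b < n)%N -> rs`_a < rs`_b.
  move=> /andP[ab bn]; rewrite lt_sorted_ltn_nth ?inE //.
  exact: ltn_trans bn.
rewrite hornerXsubC; have [ij|ji] := ltnP i j.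
  by rewrite expr1 mulN1r opprB subr_gt0 mono // ij ltn_ord.
rewrite expr0 mul1r subr_gt0 mono // lti andbT ltn_neqAle ji andbT.
by apply: contra jNi => /eqP e; apply/eqP/val_inj.
Qed.

Lemma monic_sign_infty q n : q \is monic -> size q = n.+1 ->
  exists M, forall x, M <= x -> 0 < q.[x] /\ 0 < (-1) ^+ n * q.[- x].
Proof.
move=> /monicP qm sq.
have [|M1 h1] := @poly_pinfty_gt_lc _ q; first by rewrite qm ltr01.
pose q' := (-1) ^+ n *: (q \Po (- 'X)).
have lq' : lead_coef q' = 1.
  rewrite lead_coefZ lead_coef_comp ?size_polyN ?size_polyX // qm sq mul1r.
  by rewrite lead_coefN lead_coefX -expr2 sqrr_sign.
have [|M2 h2] := @poly_pinfty_gt_lc _ q'; first by rewrite lq' ltr01.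
exists (Num.max M1 M2) => x; rewrite ge_max => /andP[/h1 l1 /h2 l2].
split; first by apply: lt_le_trans l1; rewrite qm ltr01.
move: l2; rewrite lq' /q' hornerZ horner_comp hornerN hornerX.
exact: lt_le_trans.
Qed.

Lemma alternates_on_raise p zs c : p \is monic -> size p = size zs ->
    sorted <%R zs -> alternates_on p zs -> 0 < c ->
  exists zs', [/\ size zs' = (size zs).+1, sorted <%R zs' &
    alternates_on ('X * p - c *: p^`()) zs'].
Proof.
move=> pm sp szs alt c0.
have zs0 : zs != [::].
  by rewrite -size_eq0 -sp size_poly_eq0 monic_neq0.
have [rs [srs srz rrs]] := alternates_on_roots zs0 szs alt.
have pE : p = \prod_(r <- rs) ('X - r%:P).
  rewrite {1}(@all_roots_sorted_prod_XsubC p rs) ?sp //.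
  by rewrite (monicP pm) scale1r.
set q := _ - _.
have sXp : size ('X * p) = (size rs).+2.
  by rewrite mulrC size_mulX ?monic_neq0 // sp srz.
have sd : (size (- (c *: p^`()))%R < size ('X * p)%R)%N.
  rewrite size_polyN sXp (leq_ltn_trans (size_scale_leq _ _)) //.
  by rewrite size_deriv sp -srz.
have sq : size q = (size rs).+2 by rewrite /q size_polyDl.
have qm : q \is monic.
  by rewrite monicE /q lead_coefDl // lead_coefM lead_coefX mul1r -monicE.
have [M HM] := monic_sign_infty qm sq.
(* [M] secures the signs at [B] and [- B]; the other term strictly bounds every root in absolute
   value. *)
pose B := Num.max M (1 + \sum_(r <- rs) `|r|).
have rB r : r \in rs -> - B < r < B.
  move=> rin; rewrite -ltr_norml lt_max; apply/orP; right.
  rewrite (big_rem r) //= addrCA ltr_pwDr //.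
  by rewrite ltr_pwDl ?ltr01 // sumr_ge0.
have B0 : - B < B.
  suff : 0 < B by move=> ?; rewrite gtrN.
  by rewrite lt_max; apply/orP; right; rewrite ltr_pwDl ?ltr01 // sumr_ge0.
have [qB qNB] : 0 < q.[B] /\ 0 < (-1) ^+ (size rs).+1 * q.[- B].
  by apply: HM; rewrite le_max lexx.
exists (- B :: rcons rs B); rewrite /= size_rcons srz; split=> //.
  rewrite rcons_path path_sortedE; last exact: lt_trans.
  rewrite srs andbT; apply/andP; split.
    by apply/allP => r /rB/andP[].
  by have:= mem_last (- B) rs; rewrite inE => /predU1P[->//|/rB/andP[]].
case=> [_|i]; rewrite /= size_rcons ?subn0 // !ltnS => le_i.
rewrite subSS nth_rcons; move: le_i; rewrite leq_eqVlt => /predU1P[->|lti].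
  by rewrite ltnn eqxx subnn expr0 mul1r.
rewrite lti; have /allP /(_ rs`_i (mem_nth _ lti)) /rootP pr := rrs.
rewrite /q hornerD hornerN hornerM hornerZ pr mulr0 sub0r.
have:= mulr_gt0 c0 (sign_deriv_prod_XsubC srs lti); rewrite -pE.
rewrite -(subnSK lti) exprS -subn1 subnAC subn1 -subnS.
by congr (0 < _); ring.
Qed.

End RealRoots.

(** * Hermite polynomials as exp(b D^2) x^d *)

Section Hermite.
Variable R : realType.
Implicit Types (phi : fps R) (p f psi : {poly R}) (b y : R).

Lemma derivn_mulX p k : ('X * p)^`(k) = 'X * p^`(k) + p^`(k.-1) *+ k.
Proof.
elim: k => [|k IHk]; first by rewrite !derivn0 mulr0n addr0.
rewrite derivnS IHk derivD derivM derivX mul1r derivMn -!derivnS.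
rewrite [p^`(k) + _]addrC -addrA mulrS; congr (_ + (_ + _)).
by case: k {IHk}.
Qed.

(** The last symbol is the formal derivative of [phi]: this is the commutation relation [phi(D), x]
    = phi'(D). *)
Lemma fps_diffop_mulX phi p :
  fps_diffop phi ('X * p) =
    'X * fps_diffop phi p + fps_diffop (fun k => phi k.+1 *+ k.+1) p.
Proof.
have sXp : (size ('X * p)%R <= (size p).+1)%N.
  by apply: leq_trans (size_polyMleq _ _) _; rewrite size_polyX.
rewrite (fps_diffopE _ sXp) (@fps_diffopE _ phi p (size p).+1) //.
rewrite mulr_sumr [in RHS]/fps_diffop.
under eq_bigr do rewrite derivn_mulX scalerDr scalerAr.
rewrite big_split; congr (_ + _).
rewrite big_ord_recl mulr0n scaler0 [LHS]add0r.
by apply: eq_bigr => i _; rewrite lift0 /= -scalerMnl -scalerMnr.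
Qed.

Lemma lead_coef_fps_diffop phi f :
  phi 0%N != 0 -> lead_coef (fps_diffop phi f) = phi 0%N * lead_coef f.
Proof.
move=> phi0; rewrite !lead_coefE size_fps_diffop //.
rewrite (@fps_diffopE _ _ f (size f).+1) // coef_sum big_ord_recl coefZ derivn0.
rewrite big1 ?addr0 // => i _.
rewrite coefZ coef_derivn [f`__]nth_default ?mul0rn ?mulr0 //.
rewrite lift0 addSnnS; case: (size f) i => [|n] i //=.
by rewrite leq_addl.
Qed.

(* The coefficients of exp(b X^2). *)
Fixpoint gaussian b k : R :=
  match k with
  | 0 => 1
  | 1 => 0
  | j.+2 => b *+ 2 / k%:R * gaussian b j
  end.

(* For b = -1 this is the rescaled Hermite polynomial H_d(X / 2). *)
Definition hermite b d : {poly R} := fps_diffop (gaussian b) 'X^d.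

(** Commutation relation for G = exp(b x^2), where G' = 2 b x G. The signs are arranged to fit
    [alternates_on_raise] with c = -2b. *)
Lemma hermiteS b d :
  hermite b d.+1 = 'X * hermite b d - (- (b *+ 2)) *: (hermite b d)^`().
Proof.
rewrite /hermite exprS fps_diffop_mulX scaleNr opprK; congr (_ + _).
rewrite -fps_diffop_deriv (@fps_diffopE _ _ 'X^d d.+1) ?size_polyXn //.
rewrite (@fps_diffopE _ _ 'X^d^`() d) ?size_deriv ?size_polyXn //.
rewrite big_ord_recl /= mul0rn scale0r add0r scaler_sumr; apply: eq_bigr => i _.
rewrite -[bump 0 i]/i.+1 -derivSn scalerA; congr (_ *: _).
by rewrite /= mulrAC -[_ *+ i.+2]mulr_natr divfK // pnatr_eq0.
Qed.

Lemma size_hermite b d : size (hermite b d) = d.+1.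
Proof. by rewrite size_fps_diffop ?size_polyXn ?oner_neq0. Qed.

Lemma monic_hermite b d : hermite b d \is monic.
Proof.
by rewrite monicE lead_coef_fps_diffop ?oner_neq0 // lead_coefXn mulr1.
Qed.

Lemma hermite_alternates b d : b < 0 ->
  exists zs,
    [/\ size zs = d.+1, sorted <%R zs & alternates_on (hermite b d) zs].
Proof.
move=> b0; elim: d => [|d [zs [szs srt alt]]].
  exists [:: 0]; split=> // -[|//] _ /=.
  rewrite /hermite /fps_diffop expr0 size_poly1 big_ord1 derivn0 scale1r.
  by rewrite hornerC !mul1r ltr01.
have c0 : 0 < - (b *+ 2) by rewrite oppr_gt0 pmulrn_llt0.
have sH : size (hermite b d) = size zs by rewrite szs size_hermite.
have [zs' [szs' srt' alt']] :=
  alternates_on_raise (monic_hermite b d) sH srt alt c0.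
by exists zs'; rewrite hermiteS szs' szs.
Qed.

End Hermite.

(** * The scaling limit of psi(D)^m f *)

Section CentralLimit.
Variable R : realType.
Implicit Types (f p psi : {poly R}) (y : R).
Local Open Scope classical_set_scope.

(** The scale 1/sqrt m for the exponent m = n + 1; the shift keeps it nonzero. *)
Let h (n : nat) : R := (Num.sqrt n.+1%:R)^-1.

Let h_gt0 n : 0 < h n.
Proof. by rewrite invr_gt0 sqrtr_gt0 ltr0n. Qed.

Let h_neq0 n : h n != 0. Proof. exact: lt0r_neq0. Qed.

Let sqr_h n : n.+1%:R * h n ^+ 2 = 1.
Proof. by rewrite exprVn sqr_sqrtr ?ler0n // divff // pnatr_eq0. Qed.

Let cvg_h : h @ \oo --> (0 : R).
Proof.
have -> : h = Num.sqrt \o harmonic.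
  by apply/funext => n; rewrite /h /= /harmonic sqrtrV ?ler0n.
suff : (Num.sqrt \o harmonic) @ \oo --> Num.sqrt (0 : R) by rewrite sqrtr0.
apply: continuous_cvg; first exact: sqrt_continuous.
exact: cvg_harmonic.
Qed.

Let cvg_hX k : (fun n => h n ^+ k) @ \oo --> (0 ^+ k : R).
Proof.
apply: (continuous_cvg _ (h := fun x : R => x ^+ k)) cvg_h.
exact: exprn_continuous.
Qed.

Let cvg_sumr k (F : nat -> nat -> R) (l : nat -> R) :
  (forall i, (i < k)%N -> F i @ \oo --> l i) ->
  (fun n => \sum_(i < k) F i n) @ \oo --> \sum_(i < k) l i.
Proof.
move=> Fl; apply: (@cvg_big _ _ _ _ _ _ _ _ _ (fun i : 'I_k => F i)) => [|i _].
  exact: add_continuous.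
exact: Fl.
Qed.

(* Compare coefficients in [psi * (psi ^+ n)^`() = n psi^`() * psi ^+ n]. *)
Lemma coef_exprS_rec psi n k : psi`_0 = 1 -> psi`_1 = 0 ->
  (psi ^+ n)`_k.+1 * k.+1%:R =
  \sum_(i < k) (psi`_i.+2 * i.+2%:R * (psi ^+ n)`_(k.-1 - i) * n%:R
                - psi`_i.+1 * (psi ^+ n)`_(k - i) * (k - i)%:R).
Proof.
move=> psi0 psi1.
have /(congr1 (fun p : {poly R} => p`_k)) :
    psi * (psi ^+ n)^`() = psi^`() * psi ^+ n *+ n.
  by case: n => [|n]; rewrite ?expr0 ?derivC ?mulr0 // deriv_exp exprS mulrnAr;
     congr (_ *+ _); ring.
(* Split off the terms of index 0: on the left [psi]_0 = 1[isolates the top coefficient, on the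
   right]psi[_1 = 0] kills the term. *)
rewrite coefM coefMn coefM !big_ord_recl !subn0 coef_deriv psi0 mul1r.
rewrite [psi^`()`__]coef_deriv psi1 mul0rn mul0r add0r.
rewrite -[_ *+ k.+1]mulr_natr -[_ *+ n]mulr_natr.
move/(canRL (addrK _)) ->; rewrite sumrB; congr (_ - _).
  rewrite mulr_suml; apply: eq_bigr => i _.
  rewrite lift0 coef_deriv subnS predn_sub.
  by rewrite -[_ *+ i.+2]mulr_natr.
apply: eq_bigr => i _; rewrite lift0 coef_deriv subnSK //.
by rewrite -[_ *+ (k - i)]mulr_natr mulrA.
Qed.

(** Strong induction on the recurrence. In the first sum the factor n + 1 cancels h^2 and leaves
    h^i; the second keeps h^(i+1). Only the first sum at i = 0 survives, which is the recurrence of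
    [gaussian]. *)
Lemma cvg_coef_expr psi k : psi`_0 = 1 -> psi`_1 = 0 ->
  (fun n => (psi ^+ n.+1)`_k * h n ^+ k) @ \oo --> gaussian psi`_2 k.
Proof.
move=> psi0 psi1; elim/ltn_ind: k => -[_|k IH].
  have -> : (fun n => (psi ^+ n.+1)`_0 * h n ^+ 0) = cst 1; last exact: cvg_cst.
  apply/funext => n; rewrite mulr1 /=.
  by rewrite -horner_coef0 horner_exp horner_coef0 psi0 expr1n.
pose w j n := (psi ^+ n.+1)`_j * h n ^+ j.
pose c i : R := psi`_i.+2 * i.+2%:R.
pose c' i : R := psi`_i.+1 * (k - i)%:R.
have -> : (fun n => (psi ^+ n.+1)`_k.+1 * h n ^+ k.+1) =
   (fun n => k.+1%:R^-1 * \sum_(i < k)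
     h n ^+ i * (c i * w (k.-1 - i)%N n - c' i * (h n * w (k - i)%N n))).
  apply/funext => n; have k0 : k.+1%:R != 0 :> R by rewrite pnatr_eq0.
  apply: (mulfI k0); rewrite mulVKf // mulrCA mulrA coef_exprS_rec //.
  rewrite mulr_suml; apply: eq_bigr => i _; rewrite /w /c /c'.
  rewrite mulrBl mulrBr; have lti := ltn_ord i; congr (_ - _).
    have -> : h n ^+ k.+1 = h n ^+ 2 * (h n ^+ i * h n ^+ (k.-1 - i)).
      rewrite -!exprD; congr (_ ^+ _); rewrite subnKC ?add2n ?prednK //.
        exact: leq_ltn_trans lti.
      by rewrite -ltnS prednK // (leq_ltn_trans _ lti).
    by rewrite -[RHS]mul1r -[X in _ = X * _](sqr_h n); ring.
  have -> : h n ^+ k.+1 = h n ^+ i * (h n * h n ^+ (k - i)).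
    by rewrite -exprS -exprD addnS subnKC // ltnW.
  ring.
(* Writing the limit with [0 ^+ i], where [0 ^+ 0 = 1], lets the limit be taken term by term. *)
have -> : gaussian psi`_2 k.+1 = k.+1%:R^-1 * \sum_(i < k)
     0 ^+ i * (c i * gaussian psi`_2 (k.-1 - i)
               - c' i * (0 * gaussian psi`_2 (k - i))).
  case: k @c' {IH} => [|k] c'; first by rewrite big_ord0 mulr0.
  rewrite big_ord_recl big1 ?addr0; last first.
    by move=> i _; rewrite lift0 expr0n mul0r.
  by rewrite expr0 mul0r mulr0 subr0 subn0 /= /c; ring.
apply: cvgM; first exact: cvg_cst.
apply: (cvg_sumr (F := fun i n =>
     h n ^+ i * (c i * w (k.-1 - i)%N n - c' i * (h n * w (k - i)%N n)))
  (l := fun i => 0 ^+ i * (c i * gaussian psi`_2 (k.-1 - i)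
               - c' i * (0 * gaussian psi`_2 (k - i))))) => i lti.
apply: cvgM; first exact: cvg_hX.
apply: cvgB; apply: cvgM; first [exact: cvg_cst | idtac].
  by apply: IH; rewrite ltnS (leq_trans (leq_subr _ _)) ?leq_pred.
by apply: cvgM => //; apply: IH; rewrite ltnS leq_subr.
Qed.

(** The coefficient of index i carries h^(d-i), which vanishes in the limit unless i = d. *)
Lemma cvg_scaled_horner p d y : (size p <= d.+1)%N ->
  (fun n => h n ^+ d * p.[y / h n]) @ \oo --> p`_d * y ^+ d.
Proof.
move=> sp.
have -> : (fun n => h n ^+ d * p.[y / h n]) =
    (fun n => \sum_(i < d.+1) p`_i * y ^+ i * h n ^+ (d - i)).
  apply/funext => n; rewrite (horner_coef_wide _ sp) mulr_sumr.
  apply: eq_bigr => i _; rewrite expr_div_n.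
  have le_i : (i <= d)%N by rewrite -ltnS.
  rewrite -{1}(subnK le_i) exprD.
  have hi : h n ^+ i != 0 by rewrite expf_neq0.
  by field.
have -> : p`_d * y ^+ d = \sum_(i < d.+1) p`_i * y ^+ i * 0 ^+ (d - i).
  rewrite big_ord_recr /= subnn mulr1 big1 ?add0r // => i _.
  by rewrite expr0n subn_eq0 leqNgt ltn_ord mulr0.
apply: (cvg_sumr (F := fun i n => p`_i * y ^+ i * h n ^+ (d - i))
  (l := fun i => p`_i * y ^+ i * 0 ^+ (d - i))) => i _.
by apply: cvgM; [exact: cvg_cst | exact: cvg_hX].
Qed.

(** In the k-th term h^d splits into h^k, for the coefficient of the power of [psi], and h^(d-k),
    for the derivative of degree d - k. *)
Lemma cvg_scaled_diffop psi f d y : psi`_0 = 1 -> psi`_1 = 0 ->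
    size f = d.+1 ->
  (fun n => h n ^+ d * (poly_diffop (psi ^+ n.+1) f).[y / h n]) @ \oo -->
    lead_coef f * (hermite psi`_2 d).[y].
Proof.
move=> psi0 psi1 sf.
pose F k n := (psi ^+ n.+1)`_k * h n ^+ k *
              (h n ^+ (d - k) * f^`(k).[y / h n]).
pose l k := gaussian psi`_2 k * (f^`(k)`_(d - k) * y ^+ (d - k)).
have -> : (fun n => h n ^+ d * (poly_diffop (psi ^+ n.+1) f).[y / h n]) =
    (fun n => \sum_(k < d.+1) F k n).
  apply/funext => n; rewrite /poly_diffop /fps_diffop sf horner_sum mulr_sumr.
  apply: eq_bigr => k _; have le_k : (k <= d)%N by rewrite -ltnS.
  by rewrite hornerZ /F -{1}(subnK le_k) exprD; ring.
have -> : lead_coef f * (hermite psi`_2 d).[y] = \sum_(k < d.+1) l k.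
  rewrite /hermite /fps_diffop size_polyXn horner_sum mulr_sumr.
  apply: eq_bigr => k _; have le_k : (k <= d)%N by rewrite -ltnS.
  rewrite hornerZ derivnXn hornerMn hornerXn /l coef_derivn subnKC //.
  by rewrite lead_coefE sf /= -mulr_natr -[f`_d *+ _]mulr_natr; ring.
apply: cvg_sumr => k; rewrite ltnS => le_k.
apply: cvgM; first exact: cvg_coef_expr.
by apply: cvg_scaled_horner; rewrite size_derivn sf subSn.
Qed.

(** Strict inequalities for the limit at finitely many points hold for all large n; [c] absorbs the
    scaling and the sign of the leading coefficient. *)
Lemma eventually_alternates psi f :
    psi`_0 = 1 -> psi`_1 = 0 -> psi`_2 < 0 -> f != 0 ->
  exists n0, forall n, (n0 <= n)%N -> exists zs c,
    [/\ size zs = size f, sorted <%R zs &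
        alternates_on (c *: poly_diffop (psi ^+ n.+1) f) zs].
Proof.
move=> psi0 psi1 psi2 f0; pose d := (size f).-1.
have sf : size f = d.+1 by rewrite prednK // size_poly_gt0.
have [zs [szs srt alt]] := hermite_alternates d psi2.
have lf0 : lead_coef f != 0 by rewrite lead_coef_eq0.
pose G n y := h n ^+ d * (poly_diffop (psi ^+ n.+1) f).[y / h n].
have [n0 _ Gpos] : \forall n \near \oo, forall i : 'I_d.+1,
    0 < (-1) ^+ (d - i) / lead_coef f * G n zs`_i.
  apply: filter_forall => i.
  apply: (@cvgr_gt _ _ _ _
    (fun n => (-1) ^+ (d - i) / lead_coef f * G n zs`_i)).
    by apply: cvgM; [exact: cvg_cst | exact: cvg_scaled_diffop].
  rewrite -mulrA mulKf //; have := alt i; rewrite szs /=; exact.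
exists n0 => n /Gpos {}Gpos.
exists [seq z / h n | z <- zs], (h n ^+ d / lead_coef f).
split; first by rewrite size_map szs.
  by apply: homo_sorted srt => x y; rewrite ltr_pM2r // invr_gt0 h_gt0.
move=> i; rewrite size_map szs => lti /=; rewrite (nth_map 0) ?szs //.
rewrite hornerZ; have:= Gpos (Ordinal lti); rewrite /G /=.
by congr (0 < _); ring.
Qed.

End CentralLimit.

(** * Normalization of phi and transfer of the zeros *)

Theorem theorem1p1 (R : realType) (phi : fps R)
  (phi0_neq0 : fps_deriv0 phi 0 != 0)
  (phi_lt0 : fps_deriv0 phi 2 * fps_deriv0 phi 0 - fps_deriv0 phi 1 ^+ 2 < 0)
  (f : {poly R}) (f_neq0 : f != 0) :
  exists m0 : nat, (0 < m0)%N /\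
    forall m : nat, (m0 <= m)%N ->
      all_zeros_real_simple (iter m (fps_diffop phi) f).
Proof.
have phi0 : phi 0%N != 0 by move: phi0_neq0; rewrite /fps_deriv0 mul1r.
(* [N >= size f] makes truncation exact on [f]; [N >= 3] keeps the coefficients 0, 1, 2 that enter
   [psi]. *)
pose N := (size f).+3; pose P := \poly_(i < N) phi i.
(* This makes the linear term of exp(c x) phi(x) vanish. *)
pose c := - (phi 1%N / phi 0%N).
pose E := \poly_(i < N) (c ^+ i / i`!%:R).
pose psi := (phi 0%N)^-1 *: (E * P).
have psi0 : psi`_0 = 1.
  rewrite coefZ coefM big_ord1 !coef_poly /= expr0 divr1 mul1r.
  exact: mulVf.
have psi1 : psi`_1 = 0.
  rewrite coefZ coefM !big_ord_recl big_ord0 !coef_poly /=.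
  by rewrite !factS fact0 muln1 /c; field.
have psi2 : psi`_2 < 0.
  rewrite coefZ coefM !big_ord_recl big_ord0 !coef_poly /=.
  (* The second coefficient of [psi] times 2 phi(0)^2 is phi''(0) phi(0) - phi'(0)^2. *)
  have phi02 : 0 < phi 0%N ^+ 2 *+ 2.
    by rewrite pmulrn_lgt0 // exprn_even_gt0.
  rewrite -(pmulr_llt0 _ phi02).
  move: phi_lt0; rewrite /fps_deriv0; congr (_ < 0).
  rewrite !factS fact0 !muln1 /c.
  by field.
have [n0 Hn0] := eventually_alternates psi0 psi1 psi2 f_neq0.
exists n0.+1; split=> // -[//|n]; rewrite ltnS => /Hn0[zs [a [szs srt alt]]].
set m := n.+1 in alt *; set g := iter m _ f.
have sg : size g = size f by rewrite size_iter_fps_diffop.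
(* The powers of [P] act as phi(D)^m and those of [E] as the translation by m c. *)
have shift x :
    (poly_diffop (psi ^+ m) f).[x] = (phi 0%N)^-1 ^+ m * g.[x + c *+ m].
  have sfN : (size f <= N)%N by rewrite /N !leqW.
  rewrite /psi exprZn exprMn poly_diffopZl poly_diffopM hornerZ.
  rewrite -(iter_fps_diffop _ _ sfN) -/g.
  by rewrite horner_expX_diffop // sg.
pose b := a * (phi 0%N)^-1 ^+ m.
pose zs' := [seq z + c *+ m | z <- zs].
have alt' : alternates_on (b *: g) zs'.
  move=> i; rewrite size_map => lti; rewrite (nth_map 0) // hornerZ.
  by rewrite -mulrA -shift -hornerZ; apply: alt.
have srt' : sorted <%R zs'.
  by apply: homo_sorted srt => x y; rewrite ltrD2r.
have zs'0 : zs' != [::].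
  by rewrite -size_eq0 size_map szs size_poly_eq0.
have [rs [srs srz rrs]] := alternates_on_roots zs'0 srt' alt'.
(* The strict signs at the points of [zs'] exclude a zero factor. *)
have b0 : b != 0.
  have : (0 < size zs')%N by rewrite lt0n size_eq0.
  by move/alt'; apply: contraTneq => ->; rewrite scale0r horner0 mulr0 ltxx.
(* There are as many distinct roots as the degree, so [g] splits into distinct linear factors. *)
have gE : g = lead_coef g *: \prod_(r <- rs) ('X - r%:P).
  apply: all_roots_sorted_prod_XsubC => //.
    by rewrite sg srz size_map szs.
  by apply: sub_all rrs => r; rewrite rootZ.
rewrite gE; apply: prod_XsubC_zeros_real_simple.
  by rewrite lead_coef_eq0 -size_poly_eq0 sg size_poly_eq0.
exact: lt_sorted_uniq.
Qed.
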